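(* If $D$ is a $(t,q)$-projective Hjelmslev plane, then $L(D) = \frac{q+1}{t(q^2+q+1)}$.
   Context: A covering design is a pair $(X,\mathcal{B})$ with $X$ a finite set of points and $\mathcal{B}$ a finite multiset of subsets of $X$ (blocks) such that every pair of distinct points lies together in at least one block. A projective plane of order $q$ is a $(q+1)$-uniform covering design with $q^2+q+1$ points and $q^2+q+1$ blocks in which every pair of distinct points lies in exactly one block. A $(t,q)$-projective Hjelmslev plane is a covering design $(X,\mathcal{B})$ in which any two blocks intersect, such that there exist a projective plane $(P,\mathcal{L})$ of order $q$, a partition $\{X_p:p\in P\}$ of $X$ and a partition $\{\mathcal{B}_L:L\in\mathcal{L}\}$ of $\mathcal{B}$ with: (i) for all $L\in\mathcal{L}$ and $p\in P$, $|L\cap X_p|=t$ if $p\in L$ and $0$ otherwise; (ii) any two points of $X$ occurring together in more than one block lie in the same class $X_p$; (iii) any two blocks meeting in more than one point lie in the same class $\mathcal{B}_L$. (It is known that such a plane has $|X|=|\mathcal{B}|=t^2(q^2+q+1)$, all blocks of size $t(q+1)$ and every point in $t(q+1)$ blocks.) A weighting of $X$ assigns nonnegative reals to points, $w(S)=\sum_{x\in S}w(x)$, normalised means $w(X)=1$; $L(D,w)=\max\{w(B):B\in\mathcal{B}\}$ and $L(D)$ is the infimum of $L(D,w)$ over normalised weightings $w$.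
   Formalization: The order q of the projective plane is required to be positive; for q = 0 the printed definition would make the Fano plane a (3,0)-projective Hjelmslev plane, with L(D) = 3/7 instead of 1/3. *)

(* Defs.v *)
From HB Require Import structures.
From mathcomp Require Import all_boot all_order all_algebra.
From mathcomp Require Import boolp classical_sets reals.

Set Implicit Arguments.
Unset Strict Implicit.
Unset Printing Implicit Defensive.

Import Order.TTheory GRing.Theory Num.Theory.
Local Open Scope ring_scope.

(* A finite set of points with a finite multiset of blocks. The multiset is
   the family [block] indexed by [block_index], so repeated blocks are distinct
   indices, and counting or classifying blocks means doing so for indices. *)
Record design := Design {
  point : finType;
  block_index : finType;
  block : block_index -> {set point}
}.

Definition covering_design (D : design) : Prop :=
  forall x y : point D, x != y ->
    exists i : block_index D, (x \in block i) && (y \in block i).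

Definition uniform (k : nat) (D : design) : Prop :=
  forall i : block_index D, #|block i| = k.

(* The number of blocks, with multiplicity, containing both x and y. *)
Definition pair_degree (D : design) (x y : point D) : nat :=
  #|[pred i : block_index D | (x \in block i) && (y \in block i)]|.

(* The order is required to be positive: q = 0 would admit the degenerate
   plane with one point and one line, for which the Hjelmslev axioms below no
   longer determine the number of points. *)
Definition projective_plane (q : nat) (D : design) : Prop :=
  [/\ (0 < q)%N,
      covering_design D /\ uniform q.+1 D,
      #|point D| = (q ^ 2 + q + 1)%N,
      #|block_index D| = (q ^ 2 + q + 1)%N
    & forall x y : point D, x != y -> pair_degree x y = 1%N].

(* The indexed family F partitions T. Injectivity makes classes with different
   indices different; [partition] makes them nonempty, disjoint and covering. *)
Definition partition_family (J T : finType) (F : J -> {set T}) : Prop :=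
  injective F /\ finset.partition (F @: [set: J]) [set: T].

Definition projective_Hjelmslev_plane (t q : nat) (D : design) : Prop :=
  [/\ covering_design D,
      forall i j : block_index D, i != j ->
        block i :&: block j != finset.set0
    & exists (E : design) (Xc : point E -> {set point D})
             (Bc : block_index E -> {set block_index D}),
        [/\ projective_plane q E,
            partition_family Xc /\ partition_family Bc,
            forall (l : block_index E) (p : point E) (i : block_index D),
              i \in Bc l ->
              #|block i :&: Xc p| = if p \in block l then t else 0%N,
            forall x y : point D, x != y -> (1 < pair_degree x y)%N ->
              exists p : point E, (x \in Xc p) && (y \in Xc p)
          & forall i j : block_index D, i != j ->
              (1 < #|block i :&: block j|)%N ->
              exists l : block_index E, (i \in Bc l) && (j \in Bc l)]].

Section Load.
Variables (R : realType) (D : design).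

Definition weight (w : point D -> R) (S : {set point D}) : R :=
  \sum_(x in S) w x.

Definition normalised_weighting (w : point D -> R) : Prop :=
  (forall x, 0 <= w x) /\ weight w [set: point D] = 1.

(* Weights are nonnegative, so starting the maximum at 0 only matters when
   there are no blocks. *)
Definition load (w : point D -> R) : R :=
  \big[Num.max/0]_(i : block_index D) weight w (block i).

Definition min_load : R :=
  inf [set load w | w in [set w | normalised_weighting w]]%classic.

End Load.

Arguments min_load R D : clear implicits.

(* Main.v *)
Require Import Defs.
From HB Require Import structures.
From mathcomp Require Import all_boot all_order all_algebra.
From mathcomp Require Import boolp classical_sets reals.

Set Implicit Arguments.
Unset Strict Implicit.
Unset Printing Implicit Defensive.

Import Order.TTheory GRing.Theory Num.Theory.
Local Open Scope ring_scope.

(** Write [n_p] and [b_l] for the sizes of the point and block classes, and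
    [r_(x,l)] for the number of blocks of class [l] through [x]. If [p] and
    [p'] are distinct points of [l] and [x] has class [p], then every point of
    class [p'] is on exactly one block through [x], and that block has class
    [l]; hence [n_p' = t r_(x,l)]. A block of another class [l' <> l] with
    [p] on [l'] meets each block of class [l] exactly once, in a point of class
    [p], so [b_l = t r_(x,l) = n_p']. Thus [b_l] and the [n_p] with [p] on [l]
    are one number [n], and counting the flags between class [p] and class [l]
    gives [n t = n (n / t)], so [n = t ^ 2].
    The design is therefore uniform and regular: constant weights attain the
    claimed load, and averaging the block weights shows that it is minimal. *)

(** Replaces the family by a class map, so that membership becomes an equation. Injectivity of [F]
    matters: disjointness of the parts separates indices only when distinct indices give distinct
    parts. Surjectivity of [c] says that no part is empty. *)
Lemma partition_familyP (J T : finType) (F : J -> {set T}) :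
  partition_family F ->
  exists2 c : T -> J, forall x j, (x \in F j) = (c x == j)
                    & forall j, exists x, c x = j.
Proof.
case=> injF /and3P[/eqP covF /finset.trivIsetP triF F0].
have ex x : exists j, x \in F j.
  have : x \in finset.cover (F @: [set: J]) by rewrite covF inE.
  by case/finset.bigcupP=> _ /imsetP[j _ ->] ?; exists j.
pose c x := xchoose (ex x).
have cP x j : (x \in F j) = (c x == j).
  apply/idP/eqP => [xj|<-]; last exact: (xchooseP (ex x)).
  apply/eqP; apply: contraT => ncj.
  have /triF := imset_f F (finset.in_setT (c x)) => /(_ _ (imset_f F (finset.in_setT j))).
  rewrite (inj_eq injF) => /(_ ncj) /pred0P/(_ x) /=.
  by rewrite xj (xchooseP (ex x)).
exists c => // j; have /set0Pn[x] : F j != finset.set0.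
  by apply: contraNneq F0 => <-; rewrite imset_f ?inE.
by rewrite cP => /eqP; exists x.
Qed.

Lemma double_count_flags (D : design) (A : {pred Defs.point D})
    (B : {pred block_index D}) :
  (\sum_(i in B) #|[set x in block i | A x]|
    = \sum_(x in A) #|[set i | (x \in block i) && (i \in B)]|)%N.
Proof.
under eq_bigr do rewrite -sum1_card.
under [RHS]eq_bigr do rewrite -sum1_card.
rewrite (exchange_big_dep (mem A)) /= => [|i x _]; last by rewrite inE => /andP[].
apply: eq_bigr => x xA; apply: eq_bigl => i.
by rewrite !inE (_ : A x) // andbT andbC.
Qed.

(** * Points and lines of a projective plane of order [q > 0] *)

Lemma projective_plane_line_unique q (E : design) (p p' : Defs.point E)
    (l l' : block_index E) :
  projective_plane q E -> p != p' -> p \in block l -> p' \in block l ->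
  p \in block l' -> p' \in block l' -> l = l'.
Proof.
move=> [_ _ _ _ deg] npp' pl p'l pl' p'l'.
have /card_le1_eqP : (pair_degree p p' <= 1)%N by rewrite deg.
by apply; rewrite inE ?pl ?pl'.
Qed.

Lemma projective_plane_other_point q (E : design) (p : Defs.point E)
    (l : block_index E) :
  projective_plane q E -> exists2 p', p' != p & p' \in block l.
Proof.
move=> [q0 [_ unif] _ _ _].
have : (0 < #|block l :\ p|)%N.
  rewrite -(leq_add2l (p \in block l)) -cardsD1 unif addn1.
  by case: (p \in _); rewrite ltnS.
by case/card_gt0P=> p'; rewrite !inE => /andP[]; exists p'.
Qed.

Lemma projective_plane_line q (E : design) (p : Defs.point E) :
  projective_plane q E -> exists l, p \in block l.
Proof.
move=> [q0 [cov _] cP _ _].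
have : (0 < #|[set~ p]|)%N by rewrite cardsC1 cP addn1 /= addn_gt0 q0 orbT.
case/card_gt0P=> p'; rewrite !inE eq_sym => /cov[l /andP[pl _]].
by exists l.
Qed.

(** When [p] is on [l], some [p'] is off [l] because [q + 1 < q ^ 2 + q + 1], and the line through
    [p] and [p'] differs from [l]. *)
Lemma projective_plane_other_line q (E : design) (p : Defs.point E)
    (l : block_index E) :
  projective_plane q E -> exists2 l', l' != l & p \in block l'.
Proof.
move=> plE; case: (plE) => [q0 [cov unif] cP _ _].
have [pl|npl] := boolP (p \in block l); last first.
  have [l' pl'] := projective_plane_line p plE.
  by exists l' => //; apply: contraNneq npl => <-.
have : (0 < #|~: block l|)%N.
  rewrite cardsCs finset.setCK unif cP subn_gt0 addn1 ltnS.
  by rewrite -[X in (X < _)%N]add0n ltn_add2r expn_gt0 q0.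
case/card_gt0P=> p'; rewrite inE => np'l.
have npp' : p != p' by apply: contraNneq np'l => <-.
have [l' /andP[pl' p'l']] := cov _ _ npp'.
by exists l' => //; apply: contraNneq np'l => <-.
Qed.

(** * Class sizes and degrees in a Hjelmslev plane, with [cp] and [cb] sending points and blocks to
    their classes *)

Section Counting.
Variables (t q : nat) (D E : design).
Variables (cp : Defs.point D -> Defs.point E) (cb : block_index D -> block_index E).
Hypothesis plane_E : projective_plane q E.
Hypothesis cp_surj : forall p, exists x, cp x = p.
Hypothesis cb_surj : forall l, exists i, cb i = l.
Hypothesis card_block_class : forall i p,
  #|[set x in block i | cp x == p]| = if p \in block (cb i) then t else 0%N.
Hypothesis pair_degree1 : forall x y : Defs.point D,
  cp x != cp y -> pair_degree x y = 1%N.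
Hypothesis card_blockI1 : forall i j : block_index D,
  cb i != cb j -> #|block i :&: block j| = 1%N.

Let n p := #|[set x | cp x == p]|.
Let b l := #|[set i | cb i == l]|.
Let r x l := #|[set i | (x \in block i) && (cb i == l)]|.

Lemma class_incident x i : x \in block i -> cp x \in block (cb i).
Proof.
move=> xi; have := card_block_class i (cp x); case: ifP => // _ /eqP.
by rewrite cards_eq0 => /eqP/setP/(_ x); rewrite !inE xi eqxx.
Qed.

(** Two blocks of different classes share a point [x], and the points of class [cp x] on either
    block number [t]. *)
Lemma t_gt0 : (0 < t)%N.
Proof.
have /card_gt0P[p _] : (0 < #|Defs.point E|)%N.
  by case: plane_E => [_ _ -> _ _]; rewrite addn1.
have [l pl] := projective_plane_line p plane_E.
have [l' ll' _] := projective_plane_other_line p l plane_E.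
have [[i ci] [j cj]] := (cb_surj l, cb_surj l').
have /card_blockI1 cij : cb i != cb j by rewrite ci cj eq_sym.
have /card_gt0P[x] : (0 < #|block i :&: block j|)%N by rewrite cij.
rewrite inE => /andP[xi _].
have := card_block_class i (cp x); rewrite class_incident // => <-.
by apply/card_gt0P; exists x; rewrite inE xi eqxx.
Qed.

Lemma class_size_degree x l p :
  cp x \in block l -> p \in block l -> cp x != p -> n p = (t * r x l)%N.
Proof.
move=> xl pl nxp.
have -> : n p = (\sum_(y | cp y == p) pair_degree x y)%N.
  rewrite /n -sum1_card; apply: eq_big => [y|y]; rewrite inE //.
  by move=> /eqP yp; rewrite pair_degree1 // yp.
transitivity (\sum_(i in [set i | x \in block i])
                #|[set y in block i | cp y == p]|)%N.
  rewrite (double_count_flags [pred y | cp y == p]); apply: eq_bigr => y _.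
  by apply: eq_card => i; rewrite !inE andbC.
under eq_bigr do rewrite card_block_class.
(* A block through [x] contributes [t] when its line contains [p]; that line contains [cp x] too, so
   it can only be [l]. *)
rewrite -big_mkcondr /= sum_nat_const mulnC; congr (_ * _)%N.
apply: eq_card => i; rewrite unfold_in /= !inE; case: (boolP (x \in block i)) => //= xi.
apply/idP/eqP => [pi|-> //].
by apply: (projective_plane_line_unique plane_E nxp) => //; exact: class_incident.
Qed.

Lemma block_class_size l p : p \in block l -> b l = n p.
Proof.
move=> pl; have [p' np'p p'l] := projective_plane_other_point p l plane_E.
have [l' nl'l p'l'] := projective_plane_other_line p' l plane_E.
have [i ci] := cb_surj l'.
apply/eqP; rewrite -(eqn_pmul2l t_gt0); apply/eqP.
(* Each block of class [l] meets the fixed block [i] in exactly one point. *)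
have -> : b l = (\sum_(x in block i) r x l)%N.
  transitivity (\sum_(j in [set j | cb j == l])
                  #|[set x in block j | x \in block i]|)%N.
    rewrite /b -sum1_card; apply: eq_bigr => j; rewrite inE => /eqP cj.
    have /card_blockI1 <- : cb j != cb i by rewrite cj ci eq_sym.
    by apply: eq_card => x; rewrite !inE.
  rewrite (double_count_flags (mem (block i))); apply: eq_bigr => x _.
  by apply: eq_card => j; rewrite !inE.
(* Only class [p'] contributes: a point on [i] and on a block of class [l] has its class on both
   [l'] and [l], which meet only in [p']. *)
rewrite (bigID [pred x | cp x == p']) /= [X in (_ + X)%N]big1 ?addn0; last first.
  move=> x /andP[xi ncx]; apply/eqP; rewrite cards_eq0; apply: contraNT ncx.
  case/set0Pn=> j; rewrite inE => /andP[/class_incident xj /eqP cj].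
  apply/eqP/eqP; apply: contraNT nl'l => ncx; apply/eqP.
  apply: (projective_plane_line_unique plane_E ncx) => //.
    by rewrite -ci class_incident.
  by rewrite -cj.
(* The factor [t] turns each term into [t * r x l = n p]; block [i] has [t] points of class [p']. *)
rewrite big_distrr /= (eq_bigr (fun=> n p)) => [|x /andP[_ /eqP cx]]; last first.
  by rewrite (@class_size_degree x l) ?cx.
have := card_block_class i p'; rewrite ci p'l' => {1}<-.
by rewrite sum_nat_const; congr (_ * _)%N; apply: eq_card => x; rewrite !inE.
Qed.

Lemma class_size p : n p = (t ^ 2)%N.
Proof.
have [l pl] := projective_plane_line p plane_E.
have [p' np'p p'l] := projective_plane_other_point p l plane_E.
have np' : n p' = n p by rewrite -(block_class_size p'l) (block_class_size pl).
have flags : (b l * t = \sum_(x | cp x == p) r x l)%N.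
  transitivity (\sum_(i in [set i | cb i == l])
                  #|[set x in block i | cp x == p]|)%N.
    rewrite (eq_bigr (fun=> t)) ?sum_nat_const // => i; rewrite inE => /eqP ci.
    by rewrite card_block_class ci pl.
  rewrite (double_count_flags [pred x | cp x == p]); apply: eq_bigr => x _.
  by apply: eq_card => i; rewrite !inE.
have n0 : (0 < n p)%N.
  by have [x <-] := cp_surj p; apply/card_gt0P; exists x; rewrite inE.
(* Multiply [flags] by [t]: each of the [n p] summands becomes [t * r x l = n p'], using the second
   point [p'] of [l]. *)
have : (n p * t ^ 2 = n p * n p)%N.
  rewrite -{1}(block_class_size pl) mulnA flags mulnC big_distrr /=.
  rewrite (eq_bigr (fun=> n p)) => [|x /eqP cx].
    by rewrite sum_nat_const; congr (_ * _)%N; apply: eq_card => x; rewrite !inE.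
  by rewrite -np' (@class_size_degree x l) ?cx // eq_sym.
by move/eqP; rewrite eqn_pmul2l // => /eqP.
Qed.

Lemma card_points : #|Defs.point D| = (t ^ 2 * (q ^ 2 + q + 1))%N.
Proof.
case: plane_E => [_ _ <- _ _]; rewrite -sum1_card (partition_big cp predT) //=.
rewrite (eq_bigr (fun=> t ^ 2)%N) ?sum_nat_const 1?[RHS]mulnC // => p _.
by rewrite -(class_size p) /n -sum1_card; apply: eq_bigl => x; rewrite inE.
Qed.

Lemma card_blocks : #|block_index D| = (t ^ 2 * (q ^ 2 + q + 1))%N.
Proof.
case: (plane_E) => [_ _ _ <- _]; rewrite -sum1_card (partition_big cb predT) //=.
rewrite (eq_bigr (fun=> t ^ 2)%N) ?sum_nat_const 1?[RHS]mulnC // => l _.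
have /card_gt0P[p pl] : (0 < #|block l|)%N by case: (plane_E) => [_ [_ ->]].
rewrite -(class_size p) -(block_class_size pl) /b -sum1_card.
by apply: eq_bigl => x; rewrite inE.
Qed.

Lemma card_block (i : block_index D) : #|block i| = (t * q.+1)%N.
Proof.
rewrite -sum1_card (partition_big cp predT) //=.
rewrite (eq_bigr (fun p => if p \in block (cb i) then t else 0%N)) => [|p _].
  rewrite -big_mkcond sum_nat_const mulnC.
  by case: plane_E => [_ [_ ->]].
rewrite -card_block_class -sum1_card.
by apply: eq_bigl => x; rewrite inE.
Qed.

Lemma point_degree (x : Defs.point D) : #|[set i | x \in block i]| = (t * q.+1)%N.
Proof.
(* Count the points outside the class of [x] along the blocks through [x]. *)
case: (plane_E) => [q0 _ _ _ _].
have cc : #|[set y | cp y != cp x]| = (t ^ 2 * (q ^ 2 + q))%N.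
  have := cardsC [set y | cp y == cp x].
  rewrite -/(n (cp x)) class_size card_points mulnDr muln1 addnC => /addIn <-.
  by apply: eq_card => y; rewrite !inE.
have flags : (#|[set i | x \in block i]| * (t * q) = t ^ 2 * (q ^ 2 + q))%N.
  rewrite -cc; transitivity (\sum_(i in [set i | x \in block i])
                #|[set y in block i | cp y != cp x]|)%N.
    rewrite (eq_bigr (fun=> t * q)%N) ?sum_nat_const // => i; rewrite inE => xi.
    (* Of the [t * q.+1] points on a block through [x], exactly [t] share the class of [x]. *)
    have := cardsID [set y | cp y == cp x] (block i).
    rewrite card_block mulnS.
    have -> : block i :&: [set y | cp y == cp x] = [set y in block i | cp y == cp x].
      by apply/setP => y; rewrite !inE.
    rewrite card_block_class class_incident // => /addnI <-.
    by apply: eq_card => y; rewrite !inE andbC.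
  rewrite (double_count_flags [pred y | cp y != cp x]) -sum1_card.
  apply: eq_big => [y|y /=]; first by rewrite !inE.
  rewrite inE => nyx; rewrite -(pair_degree1 nyx).
  by apply: eq_card => i; rewrite !inE.
apply/eqP; rewrite -(@eqn_pmul2r (t * q)) ?muln_gt0 ?t_gt0 //.
by rewrite flags mulnACA mulnn mulSn mulnn [(q + _)%N]addnC.
Qed.

End Counting.

(** * The minimal load of a uniform regular design with as many blocks as points *)

Lemma le_load (R : realType) (D : design) (w : Defs.point D -> R) i :
  weight w (block i) <= load w.
Proof. by rewrite /load (bigD1 i) //= le_max lexx. Qed.

Lemma min_load_uniform_regular (R : realType) (D : design) (k m : nat) :
  (0 < #|Defs.point D|)%N -> #|Defs.point D| = m -> #|block_index D| = m ->
  (forall i : block_index D, #|block i| = k) ->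
  (forall x : Defs.point D, #|[set i | x \in block i]| = k) ->
  min_load R D = k%:R / m%:R.
Proof.
move=> D0 cP cB unif reg.
have m0 : 0 < m%:R :> R by rewrite ltr0n -cP.
pose S := [set load w | w in [set w | @normalised_weighting R D w]]%classic.
have lbS : lbound S (k%:R / m%:R).
  move=> _ [w [w0 w1] <-]; rewrite ler_pdivrMr //.
  (* Each point lies in [k] blocks and the total weight is 1; the largest of the [m] block weights
     is at least their average. *)
  have <- : \sum_i weight w (block i) = k%:R.
    rewrite /weight (exchange_big_dep predT) //=.
    rewrite (eq_bigr (fun x => w x * k%:R)) => [|x _].
      rewrite -mulr_suml -[RHS]mul1r -w1; congr (_ * _).
      by apply: eq_bigl => x; rewrite inE.
    rewrite sumr_const -(reg x) mulr_natr; congr (_ *+ _).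
    by apply: eq_card => i; rewrite !inE.
  apply: (le_trans (ler_sum _ (fun i _ => le_load w i))).
  by rewrite sumr_const cB mulr_natr.
have Sc : S (k%:R / m%:R).
  have sumw (A : {set Defs.point D}) : weight (fun=> m%:R^-1) A = #|A|%:R / m%:R :> R.
    by rewrite /weight sumr_const mulr_natl.
  exists (fun=> m%:R^-1).
    split=> [x|]; first by rewrite invr_ge0 ltW.
    by rewrite sumw cardsT cP divff // gt_eqF.
  have /card_gt0P[i _] : (0 < #|block_index D|)%N by rewrite cB -cP.
  apply/eqP; rewrite eq_le; apply/andP; split.
    (* The bound must also cover the starting value 0 of the maximum. *)
    rewrite /load; elim/big_ind: _ => [|x y xk yk|j _].
    - by rewrite divr_ge0 ?ler0n.
    - by rewrite ge_max xk.
    - by rewrite sumw unif.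
  by rewrite -(unif i) -sumw le_load.
apply/eqP; rewrite eq_le; apply/andP; split.
  (* The same number first witnesses that [S] is bounded below, then that [S] is nonempty. *)
  by apply: ge_inf => //; exists (k%:R / m%:R).
by apply: lb_le_inf => //; exists (k%:R / m%:R).
Qed.

Theorem theorem6p7 (R : realType) (t q : nat) (D : design) :
  projective_Hjelmslev_plane t q D ->
  min_load R D = (q%:R + 1) / (t%:R * (q%:R ^+ 2 + q%:R + 1)).
Proof.
move=> [cov meet [E [Xc [Bc [plE [partX partB] inc pts blks]]]]].
have [cp cpP cpS] := partition_familyP partX.
have [cb cbP cbS] := partition_familyP partB.
have inc' i p :
    #|[set x in block i | cp x == p]| = if p \in block (cb i) then t else 0%N.
  have iB : i \in Bc (cb i) by rewrite cbP.
  by rewrite -(inc _ p _ iB); apply: eq_card => x; rewrite !inE cpP.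
(* Covering gives at least one common block; two would force [x] and [y] into one class. Dually for
   blocks in [meet1]. *)
have deg1 x y : cp x != cp y -> pair_degree x y = 1%N.
  move=> nxy; have nxy' : x != y by apply: contraNneq nxy => ->.
  apply/eqP; rewrite eqn_leq; apply/andP; split.
    rewrite leqNgt; apply: contraNN nxy => /(pts _ _ nxy')[p].
    by rewrite !cpP => /andP[/eqP -> /eqP ->].
  by have [i xyi] := cov _ _ nxy'; apply/card_gt0P; exists i.
have meet1 i j : cb i != cb j -> #|block i :&: block j| = 1%N.
  move=> nij; have nij' : i != j by apply: contraNneq nij => ->.
  apply/eqP; rewrite eqn_leq; apply/andP; split.
    rewrite leqNgt; apply: contraNN nij => /(blks _ _ nij')[l].
    by rewrite !cbP => /andP[/eqP -> /eqP ->].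
  by rewrite card_gt0 meet.
have t0 := t_gt0 plE cbS inc' meet1.
have cP := card_points plE cpS cbS inc' deg1 meet1.
have cB := card_blocks plE cpS cbS inc' deg1 meet1.
have unif := card_block plE inc'.
have reg := point_degree plE cpS cbS inc' deg1 meet1.
rewrite (min_load_uniform_regular R _ cP cB unif reg); last first.
  by rewrite cP muln_gt0 expn_gt0 t0 addn1.
(* Writing [t ^ 2] as [t * t] isolates a factor [t / t], which is 1 since [t > 0]. *)
rewrite -mulnn -mulnA !natrM -natr1 !natrD natrX -mulf_div divff ?mul1r //.
by rewrite pnatr_eq0 -lt0n.
Qed.
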